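(* Let $M$ be a compact metric space. For every homeomorphism $h : M \to M$ of $M$ onto $M$, the induced map $\widetilde{h} : \mathcal{M}(M) \to \mathcal{M}(M)$ is chain mixing.
   Context: For a compact metric space $(M,d)$, $\mathcal{M}(M)$ is the space of Borel probability measures on $M$ with the Prohorov metric $d_P(\mu,\nu)=\inf\{\delta>0:\mu(X)\le\nu(X^\delta)+\delta \text{ and } \nu(X)\le\mu(X^\delta)+\delta \text{ for all Borel } X\subset M\}$, where $X^\delta=\{x\in M: d(x,X)<\delta\}$; it is a compact metric space. For a continuous map $f:M\to M$, the induced map $\widetilde f:\mathcal{M}(M)\to\mathcal{M}(M)$ is $(\widetilde f(\mu))(X)=\mu(f^{-1}(X))$ for Borel $X$. Let $g$ be a continuous self-map of a compact metric space with metric $\rho$ and let $\delta>0$. A finite sequence $(x_n)_{n=0,1,\dots,k}$ is a $\delta$-chain from $x_0$ to $x_k$ of length $k$ if $\rho(g(x_n),x_{n+1})<\delta$ for all $n=0,1,\dots,k-1$. The map $g$ is chain mixing if for every $\delta>0$ and every pair of points $x,y$ there exists $k_0\in\mathbb{N}$ such that for all $k\ge k_0$ there exists a $\delta$-chain from $x$ to $y$ of length $k$. *)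

(* Defs.v *)
From HB Require Import structures.
From mathcomp Require Import all_boot all_order all_algebra.
From mathcomp Require Import all_classical all_reals all_analysis.

Set Implicit Arguments.
Unset Strict Implicit.
Unset Printing Implicit Defensive.

Import Order.TTheory GRing.Theory Num.Theory.

Local Open Scope classical_set_scope.
Local Open Scope ring_scope.

(* Measurable types are pointed in MathComp-Analysis, so metric spaces carrying
   Borel measures are taken with a base point; all this adds is that the space
   is nonempty. *)
#[short(type="pmetricType")]
HB.structure Definition PointedMetric (K : numDomainType) :=
  {M of Metric K M & Pointed M}.

Definition borelType (K : numDomainType) (M : pmetricType K) :=
  g_sigma_algebraType (@open M).

(* An element is a set function on all of [set M], whose values off the Borel
   sets are arbitrary: two elements denote the same Borel measure when they
   agree on Borel sets. The Prohorov distance only looks at Borel sets. *)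
Definition borel_probability (R : realType) (M : pmetricType R) :=
  probability (borelType M) R.

(* Extended-real valued, so that the distance to the empty set is [+oo]. *)
Definition set_dist (R : realType) (M : pmetricType R) (x : M) (X : set M) :
    \bar R :=
  ereal_inf [set (mdist x y)%:E | y in X].

Definition thickening (R : realType) (M : pmetricType R) (X : set M) (d : R) :
    set M :=
  [set x | (set_dist x X < d%:E)%E].

(* The real infimum is meaningful: the set is bounded below by 0 and
   contains 1. *)
Definition prohorov (R : realType) (M : pmetricType R)
    (mu nu : borel_probability M) : R :=
  inf [set d : R | 0 < d /\
    forall X : set (borelType M), measurable X ->
      (mu X <= nu (thickening X d) + d%:E)%E /\
      (nu X <= mu (thickening X d) + d%:E)%E].

Lemma continuous_borel_measurable (R : realType) (M : pmetricType R)
    (f : M -> M) :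
  continuous f ->
  measurable_fun [set: borelType M] (f : borelType M -> borelType M).
Proof.
move=> /continuousP cf.
apply: (@measurability _ _ (borelType M) (borelType M) setT f (@open M)) => //.
move=> _ [B oB <-].
by rewrite setTI; apply: sub_sigma_algebra; exact: cf.
Qed.

Definition borel_map (R : realType) (M : pmetricType R) (f : M -> M)
    (cf : continuous f) : {mfun borelType M >-> borelType M} :=
  mfun_Sub (mem_set (continuous_borel_measurable cf)).

(* [distribution mu g] is the pushforward [fun X => mu (g @^-1` X)], as a
   probability measure. *)
Definition induced_map (R : realType) (M : pmetricType R) (f : M -> M)
    (cf : continuous f) (mu : borel_probability M) : borel_probability M :=
  distribution mu (borel_map cf).

Lemma induced_mapE (R : realType) (M : pmetricType R) (f : M -> M)
    (cf : continuous f) (mu : borel_probability M) (X : set M) :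
  induced_map cf mu X = mu (f @^-1` X).
Proof. by []. Qed.

Definition homeomorphism (S T : topologicalType) (h : S -> T) :=
  continuous h /\
  exists k : T -> S, [/\ continuous k, cancel h k & cancel k h].

Lemma homeomorphism_continuous (S T : topologicalType) (h : S -> T) :
  homeomorphism h -> continuous h.
Proof. by case. Qed.

(* Only the values of [u] at [0, ..., k] matter. *)
Definition delta_chain (R : realType) (X : Type) (rho : X -> X -> R)
    (g : X -> X) (d : R) (x y : X) (k : nat) (u : nat -> X) :=
  [/\ u 0 = x, u k = y & forall n, (n < k)%N -> rho (g (u n)) (u n.+1) < d].

Definition chain_mixing (R : realType) (X : Type) (rho : X -> X -> R)
    (g : X -> X) :=
  forall d : R, 0 < d -> forall x y : X,
    exists k0 : nat, forall k : nat, (k0 <= k)%N ->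
      exists u : nat -> X, delta_chain rho g d x y k u.

(* Main.v *)
From HB Require Import structures.
Require Import Defs.
From mathcomp Require Import all_boot all_order all_algebra.
From mathcomp Require Import all_classical all_reals all_analysis.
From mathcomp Require Import ring lra.

(** Interpolate linearly between the forward orbit of [mu] and the backward
    orbit of [nu]: for [0 <= n <= k] put
    [u n := (1 - n/k) (h_* )^n mu + (n/k) (h_* )^(n-k) nu].
    Then [u 0 = mu], [u k = nu], and [h_* (u n)] and [u (n+1)] are mixtures of
    the same two measures with weights differing by [1/k], so that they are at
    Prohorov distance at most [1/k]. *)

Import Order.TTheory GRing.Theory Num.Theory.

Local Open Scope classical_set_scope.
Local Open Scope ring_scope.

(** The two interpolations differ by [(s - t) * (b - a)], and [b - a] has absolute value at most
    1. *)
Lemma le_interpolation (R : realFieldType) (a b s t d : R) :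
  0 <= a <= 1 -> 0 <= b <= 1 -> `|s - t| <= d ->
  (1 - s) * a + s * b <= (1 - t) * a + t * b + d.
Proof.
move=> /andP[a0 a1] /andP[b0 b1] std.
rewrite -lerBlDl (_ : _ - _ = (s - t) * (b - a)); last by ring.
apply: (le_trans (ler_norm _)); rewrite normrM -[leRHS]mulr1.
by apply: ler_pM => //; rewrite ler_norml; lra.
Qed.

Lemma continuous_iter (T : topologicalType) (f : T -> T) (n : nat) :
  continuous f -> continuous (iter n f).
Proof.
move=> cf; elim: n => [|n IH] x; first exact: cvg_id.
exact: continuous_comp (IH x) (cf _).
Qed.

Section mixture.
Context (d : measure_display) (T : measurableType d) (R : realType).
Variables (mu nu : probability T R) (t : R) (t0 : 0 <= t) (t1 : 0 <= 1 - t).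

(** Built from measure operations, so that countable additivity is inherited and only the total mass
    remains to be checked; [t0] and [t1] make both weights nonnegative scalars. *)
Definition mixture : set T -> \bar R :=
  measure_add (mscale (NngNum t1) mu) (mscale (NngNum t0) nu).

HB.instance Definition _ := Measure.on mixture.

Lemma mixtureE X : mixture X = ((1 - t)%:E * mu X + t%:E * nu X)%E.
Proof. exact: measure_addE. Qed.

Let mixture_setT : mixture setT = 1%E.
Proof. by rewrite mixtureE !probability_setT !mule1 -EFinD subrK. Qed.

HB.instance Definition _ :=
  Measure_isProbability.Build _ _ _ mixture mixture_setT.

End mixture.

Section borel_probabilities.
Context (R : realType) (M : pmetricType R).
Implicit Types (mu nu : borel_probability M) (X : set M).

Lemma subset_thickening X (d : R) : 0 < d -> X `<=` thickening X d.
Proof.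
move=> d0 x Xx; rewrite /thickening /set_dist /=.
apply: (@le_lt_trans _ _ (mdist x x)%:E); last by rewrite mdistxx lte_fin.
by apply: ereal_inf_lbound; exists x.
Qed.

(** By the triangle inequality, a point at distance less than [d] from [y] in [X] keeps a ball of
    radius [d - mdist x y] inside. Openness is what makes the thickening Borel. *)
Lemma thickening_open X (d : R) : open (thickening X d).
Proof.
rewrite openE => x /ereal_inf_lt[_ [y Xy <-]]; rewrite lte_fin => xyd.
rewrite /interior -nbhs_ballE; exists (d - mdist x y) => /=.
  by rewrite subr_gt0.
move=> z; rewrite ballEmdist /= => xz.
rewrite /thickening /set_dist /=.
apply: (@le_lt_trans _ _ (mdist z y)%:E).
  by apply: ereal_inf_lbound; exists y.
rewrite lte_fin (le_lt_trans (metric_triangle z x y))// metric_sym.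
by rewrite -ltrBrDr.
Qed.

(** By monotonicity, replacing [X] by its thickening only enlarges the right-hand sides: a total
    variation bound is a Prohorov bound. *)
Lemma prohorov_le mu nu (d : R) : 0 < d ->
  (forall X : set (borelType M), measurable X ->
    (mu X <= nu X + d%:E)%E /\ (nu X <= mu X + d%:E)%E) ->
  prohorov mu nu <= d.
Proof.
move=> d0 H; apply: ge_inf; first by exists 0 => e [/ltW].
split=> // X mX; have [munu numu] := H X mX.
have mXd : measurable (thickening X d : set (borelType M)).
  by apply: sub_sigma_algebra; exact: thickening_open.
have XXd : X `<=` thickening X d by exact: subset_thickening.
by split; [apply: (le_trans munu)|apply: (le_trans numu)];
   rewrite leeD2r// le_measure// inE.
Qed.

End borel_probabilities.

Theorem theorem13 (R : realType) (M : pmetricType R)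
    (cM : compact [set: M]) (h : M -> M) (hh : homeomorphism h) :
  chain_mixing (@prohorov R M) (induced_map (homeomorphism_continuous hh)).
Proof.
move=> d d0 mu nu; have [ch [g [cg _ gK]]] := hh.
(* Chains have length [k.+1] with [N <= k], so the weight increment [k.+1%:R^-1] is below [d]. *)
have [N _ HN] := near_infty_natSinv_lt (PosNum d0).
exists N.+1 => -[//|k] Nk.
have kd : k.+1%:R^-1 < d by exact: HN.
pose forward n := induced_map (continuous_iter _ _ n ch) mu.
pose backward n := induced_map (continuous_iter _ _ (k.+1 - n) cg) nu.
pose weight n : R := n%:R / k.+1%:R.
(* The weights are nonnegative only up to [n = k.+1]; beyond that [mu] is a default value. *)
have /choice[u uE] : forall n, exists P : borel_probability M,
    (n <= k.+1)%N -> forall X : set M,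
      P X = ((1 - weight n)%:E * forward n X + (weight n)%:E * backward n X)%E.
  move=> n; have [nk|] := leqP n k.+1; last by exists mu.
  have t0 : 0 <= weight n by exact: divr_ge0.
  have t1 : 0 <= 1 - weight n.
    by rewrite subr_ge0 /weight ler_pdivrMr// mul1r ler_nat.
  exists (mixture _ _ _ (forward n) (backward n) _ t0 t1) => _ X.
  exact: mixtureE.
(* The endpoints must be [mu] and [nu] themselves, not merely measures with the
   same values. *)
pose v n := if n == 0%N then mu else if n == k.+1 then nu else u n.
exists v; split=> [//||n nk]; first by rewrite /v eqxx.
have vE m : (m <= k.+1)%N -> forall X : set M,
    v m X = ((1 - weight m)%:E * forward m X + (weight m)%:E * backward m X)%E.
  move=> mk X; rewrite /v; case: eqP => [->|_].
    by rewrite /weight mul0r subr0 mul1e mul0e adde0.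
  case: eqP => [->|_]; last exact: uE.
  rewrite /weight divff ?gt_eqF// subrr mul0e mul1e add0e.
  by rewrite /backward subnn.
apply: le_lt_trans kd; apply: prohorov_le; first by rewrite invr_gt0.
move=> X mX.
(* Pushing forward by [h] keeps the weights and advances both orbits by one step. *)
have hE : induced_map (homeomorphism_continuous hh) (v n) X =
    ((1 - weight n)%:E * forward n.+1 X + (weight n)%:E * backward n.+1 X)%E.
  have bE : backward n (h @^-1` X) = backward n.+1 X.
    (* As [n < k.+1], the exponent is positive and [h] cancels the outermost [g]. *)
    have gE : h \o iter (k.+1 - n) g = iter (k.+1 - n.+1) g.
      by rewrite subSS subSn//; apply/funext => x /=; rewrite gK.
    have backwardE m (Y : set M) :
      backward m Y = nu (iter (k.+1 - m) g @^-1` Y) by [].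
    by rewrite !backwardE -gE.
  have fE : forward n (h @^-1` X) = forward n.+1 X by [].
  by rewrite induced_mapE (vE _ (ltnW nk)) bE fE.
rewrite hE vE//.
(* Values of probabilities are finite, which reduces the claim to real numbers in the unit
   interval. *)
have prob (P : borel_probability M) :
    exists2 p : R, 0 <= p <= 1 & P X = p%:E.
  exists (fine (P X)); last by rewrite fineK// fin_num_measure.
  by rewrite -!lee_fin fineK ?fin_num_measure// measure_ge0 probability_le1.
have [a a01 ->] := prob (forward n.+1); have [b b01 ->] := prob (backward n.+1).
have wd : `|weight n.+1 - weight n| <= k.+1%:R^-1.
  by rewrite /weight -mulrBl -natrB// subSnn mul1r ger0_norm// invr_ge0.
rewrite -!EFinM -!EFinD !lee_fin.
by split; apply: le_interpolation => //; rewrite distrC.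
Qed.
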